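(* Let $L,M,N$ be positive integers and let $g:=\{g_l\}_{l\in\mathbb{N}_L}\subset\ell^2(\mathbb{Z}\times\mathbb{Z},\mathbb{R})$. If $$B:=M^2\max_{k\in\mathbb{N}_N^2}\sum_{p\in\mathbb{Z}^2}\left|\left(\sum_{l\in\mathbb{N}_L}\mathcal{M}_{g_l}(k)\mathcal{M}_{g_l}^t(k)\right)_{0_{\mathbb{Z}^2},p}\right|<\infty,$$ then $\mathcal{G}(g,L,M,N)$ is a Bessel Gabor system for $\ell^2(\mathbb{Z}\times\mathbb{Z},\mathbb{H})$ with Bessel bound $B$. If also $$A:=M^2\min_{k\in\mathbb{N}_N^2}\sum_{l\in\mathbb{N}_L}\left[\left(\mathcal{M}_{g_l}(k)\mathcal{M}_{g_l}^t(k)\right)_{0_{\mathbb{Z}^2},0_{\mathbb{Z}^2}}-\sum_{0_{\mathbb{Z}^2}\ne p\in\mathbb{Z}^2}\left|\left(\mathcal{M}_{g_l}(k)\mathcal{M}_{g_l}^t(k)\right)_{0_{\mathbb{Z}^2},p}\right|\right]>0,$$ then $\mathcal{G}(g,L,M,N)$ is a Gabor frame for $\ell^2(\mathbb{Z}\times\mathbb{Z},\mathbb{H})$ with frame bounds $A\le B$.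
   Context: $\mathbb{H}$ is the algebra of real quaternions with imaginary units $i,j,ij$. For a positive integer $K$, $\mathbb{N}_K:=\{0,1,\dots,K-1\}$. $\ell^2(\mathbb{Z}\times\mathbb{Z},\mathbb{H})$ is the right quaternionic Hilbert space of functions $f:\mathbb{Z}^2\to\mathbb{H}$ with $\sum_{k\in\mathbb{Z}^2}|f(k)|^2<\infty$, with inner product $\langle f,g\rangle=\sum_{k\in\mathbb{Z}^2}\overline{f(k)}\,g(k)$; $\ell^2(\mathbb{Z}\times\mathbb{Z},\mathbb{R})$ is the subset of real-valued ones. For $n\in\mathbb{Z}^2$, $(T_{nN}f)(k)=f(k-nN)$ where $nN=(n_1N,n_2N)$. For $m=(m_1,m_2)\in\mathbb{N}_M^2$, $(E_{\frac mM}f)(k)=e^{2\pi i\frac{m_1}{M}k_1}f(k)e^{2\pi j\frac{m_2}{M}k_2}$, $k=(k_1,k_2)\in\mathbb{Z}^2$. The Gabor system is $\mathcal{G}(g,L,M,N):=\{E_{\frac mM}T_{nN}g_l\}_{l\in\mathbb{N}_L,\,m\in\mathbb{N}_M^2,\,n\in\mathbb{Z}^2}$. It is a frame with frame bounds $A\le B$ (where $0<A\le B<\infty$) if for all $h\in\ell^2(\mathbb{Z}\times\mathbb{Z},\mathbb{H})$: $A\|h\|^2\le\sum_{l\in\mathbb{N}_L}\sum_{n\in\mathbb{Z}^2}\sum_{m\in\mathbb{N}_M^2}|\langle E_{\frac mM}T_{nN}g_l,h\rangle|^2\le B\|h\|^2$. If only the upper inequality is required, it is a Bessel Gabor system with Bessel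 bound $B$. For $h\in\ell^2(\mathbb{Z}\times\mathbb{Z},\mathbb{H})$ and $k\in\mathbb{Z}^2$, $\mathcal{M}_h(k)$ is the matrix indexed by $\mathbb{Z}^2\times\mathbb{Z}^2$ with entries $(\mathcal{M}_h(k))_{p,n}=h(k+pM-nN)$, $p,n\in\mathbb{Z}^2$; $^t$ denotes transpose, so $(\mathcal{M}_{g_l}(k)\mathcal{M}_{g_l}^t(k))_{0_{\mathbb{Z}^2},p}=\sum_{n\in\mathbb{Z}^2}g_l(k-nN)g_l(k+pM-nN)$. $0_{\mathbb{Z}^2}=(0,0)$. *)

(* Defs.v *)
From HB Require Import structures.
From mathcomp Require Import all_boot all_order all_algebra ring.
From mathcomp Require Import all_classical all_reals all_analysis.
From mathcomp Require summability.

Set Implicit Arguments.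
Unset Strict Implicit.
Unset Printing Implicit Defensive.
Set Warnings "-redundant-canonical-projection".
Import Order.TTheory GRing.Theory Num.Theory.

Local Open Scope classical_set_scope.
Local Open Scope ring_scope.

Record quaternion (R : Type) := Quat { qre : R; qi : R; qj : R; qk : R }.

Definition tuple_of_quat (R : Type) (q : quaternion R) :=
  (qre q, qi q, qj q, qk q).
Definition quat_of_tuple (R : Type) (t : R * R * R * R) :=
  let: (a, b, c, d) := t in Quat a b c d.
Lemma tuple_of_quatK (R : Type) :
  cancel (@tuple_of_quat R) (@quat_of_tuple R).
Proof. by case. Qed.

HB.instance Definition _ (R : choiceType) :=
  Choice.copy (quaternion R) (can_type (@tuple_of_quatK R)).

Section QuaternionRing.
Context {R : comNzRingType}.
Implicit Types p q : quaternion R.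

Definition addq p q :=
  Quat (qre p + qre q) (qi p + qi q) (qj p + qj q) (qk p + qk q).
Definition oppq q := Quat (- qre q) (- qi q) (- qj q) (- qk q).

(* Hamilton product for the basis 1, i, j, ij. *)
Definition mulq p q :=
  Quat (qre p * qre q - qi p * qi q - qj p * qj q - qk p * qk q)
       (qre p * qi q + qi p * qre q + qj p * qk q - qk p * qj q)
       (qre p * qj q - qi p * qk q + qj p * qre q + qk p * qi q)
       (qre p * qk q + qi p * qj q - qj p * qi q + qk p * qre q).

Lemma addqA : associative addq.
Proof. by move=> p q r; rewrite /addq/= !addrA. Qed.
Lemma addqC : commutative addq.
Proof. by move=> p q; congr Quat; rewrite addrC. Qed.
Lemma add0q : left_id (Quat 0 0 0 0) addq.
Proof. by case=> *; rewrite /addq/= !add0r. Qed.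
Lemma addNq : left_inverse (Quat 0 0 0 0) oppq addq.
Proof. by move=> q; rewrite /addq/= !addNr. Qed.

HB.instance Definition _ :=
  GRing.isZmodule.Build (quaternion R) addqA addqC add0q addNq.

Lemma mulqA : associative mulq.
Proof. by move=> p q r; congr Quat => /=; ring. Qed.
Lemma mul1q : left_id (Quat 1 0 0 0) mulq.
Proof. by case=> a b c d; congr Quat => /=; ring. Qed.
Lemma mulq1 : right_id (Quat 1 0 0 0) mulq.
Proof. by case=> a b c d; congr Quat => /=; ring. Qed.
Lemma mulqDl : left_distributive mulq +%R.
Proof. by move=> p q r; congr Quat => /=; ring. Qed.
Lemma mulqDr : right_distributive mulq +%R.
Proof. by move=> p q r; congr Quat => /=; ring. Qed.
Lemma oneq_neq0 : Quat 1 0 0 0 != 0 :> quaternion R.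
Proof. by apply/eqP => -[] /eqP; rewrite oner_eq0. Qed.

HB.instance Definition _ := GRing.Zmodule_isNzRing.Build (quaternion R)
  mulqA mul1q mulq1 mulqDl mulqDr oneq_neq0.

Definition conjq q := Quat (qre q) (- qi q) (- qj q) (- qk q).
Definition realq (x : R) := Quat x 0 0 0.

End QuaternionRing.

Definition absq (R : rcfType) (q : quaternion R) : R :=
  Num.sqrt (qre q ^+ 2 + qi q ^+ 2 + qj q ^+ 2 + qk q ^+ 2).

Notation Z2 := (int * int)%type.

Section Gabor.
Context {R : realType}.
Notation H := (quaternion R).
Implicit Types f h : Z2 -> H.

(* Unconditional sum over Z^2; all families it is applied to below are
   absolutely summable when the sequences involved are in l^2. *)
Definition rsum (x : Z2 -> R) : R := summability.sum (x : Z2 -> R^o).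
Definition qsum f : H :=
  Quat (rsum (@qre R \o f)) (rsum (@qi R \o f))
       (rsum (@qj R \o f)) (rsum (@qk R \o f)).

Definition l2 f : Prop :=
  (\esum_(k in [set: Z2]) (absq (f k) ^+ 2)%:E < +oo)%E.
Definition inner f h : H := qsum (fun k => conjq (f k) * h k).
(* <f, f> is a nonnegative real quaternion. *)
Definition l2norm f : R := Num.sqrt (qre (inner f f)).

(* The exponentials e^{i t} and e^{j t}, given by Euler's formula. *)
Definition expi (t : R) : H := Quat (cos t) (sin t) 0 0.
Definition expj (t : R) : H := Quat (cos t) 0 (sin t) 0.

Definition translation (a : Z2) f : Z2 -> H := fun k => f (k - a).

Definition modulation (M : nat) (m : 'I_M * 'I_M) f : Z2 -> H := fun k =>
  expi (2 * pi * (m.1%:R / M%:R) * k.1%:~R) * f k *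
  expj (2 * pi * (m.2%:R / M%:R) * k.2%:~R).

Definition gabor (L M N : nat) (g : 'I_L -> Z2 -> H)
    (l : 'I_L) (m : 'I_M * 'I_M) (n : Z2) : Z2 -> H :=
  modulation m (translation (n *+ N) (g l)).

Definition gabor_energy (L M N : nat) (g : 'I_L -> Z2 -> H) h : \bar R :=
  (\sum_(l < L) \esum_(n in [set: Z2])
     \sum_(m : 'I_M * 'I_M) (absq (inner (gabor N g l m n) h) ^+ 2)%:E)%E.

Definition bessel_gabor (L M N : nat) (g : 'I_L -> Z2 -> H) (B : \bar R) :=
  (B < +oo)%E /\
  forall h, l2 h -> (gabor_energy M N g h <= B * (l2norm h ^+ 2)%:E)%E.

Definition gabor_frame (L M N : nat) (g : 'I_L -> Z2 -> H) (A B : \bar R) :=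
  [/\ (0 < A)%E, (A <= B)%E, (B < +oo)%E &
  forall h, l2 h ->
    (A * (l2norm h ^+ 2)%:E <= gabor_energy M N g h)%E /\
    (gabor_energy M N g h <= B * (l2norm h ^+ 2)%:E)%E].

Definition zmx (T : Type) := Z2 -> Z2 -> T.
Definition trzmx (T : Type) (X : zmx T) : zmx T := fun p n => X n p.
Definition mulzmx (X Y : zmx R) : zmx R :=
  fun p q => rsum (fun n => X p n * Y n q).

Definition shift_mx (T : Type) (M N : nat) (h : Z2 -> T) (k : Z2) : zmx T :=
  fun p n => h (k + p *+ M - n *+ N).

Definition gram_mx (M N : nat) (h : Z2 -> R) (k : Z2) : zmx R :=
  mulzmx (shift_mx M N h k) (trzmx (shift_mx M N h k)).

Definition ordZ2 (N : nat) (k : 'I_N * 'I_N) : Z2 := (Posz k.1, Posz k.2).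

(* The maximum and minimum below are over a nonempty set when N > 0. *)
Definition upper_bound (L M N : nat) (g : 'I_L -> Z2 -> R) : \bar R :=
  ((M%:R ^+ 2)%:E * \big[maxe/-oo]_(k : 'I_N * 'I_N)
     \esum_(p in [set: Z2])
        (`| \sum_(l < L) gram_mx M N (g l) (ordZ2 k) 0 p |%R)%:E)%E.

(* The inner sum over p may be +oo for an individual l even when the upper
   bound is finite; the minimum is then -oo. *)
Definition lower_bound (L M N : nat) (g : 'I_L -> Z2 -> R) : \bar R :=
  ((M%:R ^+ 2)%:E * \big[mine/+oo]_(k : 'I_N * 'I_N)
     \sum_(l < L) ((gram_mx M N (g l) (ordZ2 k) 0 0)%:E -
       \esum_(p in [set p : Z2 | p != 0%R])
          (`| gram_mx M N (g l) (ordZ2 k) 0 p |%R)%:E))%E.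

End Gabor.

(* Main.v *)
(* Since the g_l are real, <E_m T_nN g_l, h> is the sum over k of
   e^{-j t2} e^{-i t1} g_l(k - nN) h(k).  For finitely supported h,
   orthogonality of the exponentials over m and summation over n turn the
   frame energy into M^2 times the quadratic form of
   W(k, k') = sum_l sum_n g_l(k - nN) g_l(k' - nN) over the pairs with
   k = k' mod M.  By N-periodicity of W along the diagonal, its rows are the
   Gram rows (sum_l M_{g_l}(r) M_{g_l}^t(r))_{0,p}, r in N_N^2, so
   |2 <u, v>| <= |u|^2 + |v|^2 (Schur test) gives the bound B and diagonal
   dominance gives A.  Truncating h extends both bounds to all of l^2. *)
Require Import Defs.
From mathcomp Require Import all_boot all_order all_algebra finmap.
From mathcomp Require Import all_classical all_reals all_analysis.
From mathcomp Require Import ring lra.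
From mathcomp Require summability.
Set Implicit Arguments.
Unset Strict Implicit.
Unset Printing Implicit Defensive.
Import Order.TTheory GRing.Theory Num.Theory.
Import numFieldNormedType.Exports.
Local Open Scope classical_set_scope.
Local Open Scope ring_scope.

#[local] Notation totally := summability.totally.
#[local] Notation partial_sum := summability.partial_sum.
#[local] Existing Instance summability.totally_filter.

(** * Absolutely summable real families and their nets of finite partial sums *)

Section AbsolutelySummable.
Context {R : realType}.
Implicit Types (I : choiceType).

Definition abs_summable I (x : I -> R) : Prop :=
  (\esum_(i in [set: I]) (`|x i|)%:E < +oo)%E.

Lemma partial_sumE I (x : I -> R) (A : {fset I}) :
  partial_sum x A = \sum_(i <- A) x i.
Proof. by rewrite /partial_sum big_seq_fsetE. Qed.

Lemma ler_sum_fsubset I (x : I -> R) (A B : {fset I}) :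
  (forall i, 0 <= x i) -> (A `<=` B)%fset ->
  \sum_(i <- A) x i <= \sum_(i <- B) x i.
Proof.
move=> x0 AB; rewrite [leRHS](big_fsetID _ (mem A))/=.
rewrite (_ : [fset i | i in B & i \in A]%fset = A) ?lerDl ?sumr_ge0//.
apply/fsetP => i; rewrite !inE/= andbC.
by case: (boolP (i \in A)) => // /(fsubsetP AB).
Qed.

Lemma fset_sum_le_esum I (D : set I) (x : I -> R) (A : {fset I}) :
  (forall i, i \in A -> D i) ->
  ((\sum_(i <- A) x i)%:E <= \esum_(i in D) (x i)%:E)%E.
Proof.
move=> AD; apply: esum_ge; exists [set` A].
  by split => [|i /= /AD //]; exact: finite_fset.
by rewrite fsbig_finite//= set_fsetK sumEFin.
Qed.

Lemma esum_le_fset I (D : set I) (x : I -> R) (c : \bar R) :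
  (forall A : {fset I}, (forall i, i \in A -> D i) ->
     ((\sum_(i <- A) x i)%:E <= c)%E) ->
  (\esum_(i in D) (x i)%:E <= c)%E.
Proof.
move=> h; apply: ge_ereal_sup => _ [X [finX XD] <-].
rewrite fsbig_finite//= sumEFin; apply: h => i.
by rewrite in_fset_set// inE => /XD.
Qed.

Lemma esum_fin I (D : set I) (x : I -> R) :
  (forall i, 0 <= x i) -> (\esum_(i in D) (x i)%:E < +oo)%E ->
  (\esum_(i in D) (x i)%:E)%E \is a fin_num.
Proof.
move=> x0 h; rewrite ge0_fin_numE//.
by apply: esum_ge0 => i _; rewrite lee_fin.
Qed.

(** Some finite subset comes within [e] of the supremum; by monotonicity every larger finite set
    stays between it and the supremum. *)
Lemma cvg_partial_sum_ge0 I (x : I -> R) :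
  (forall i, 0 <= x i) -> (\esum_(i in [set: I]) (x i)%:E < +oo)%E ->
  partial_sum x @ totally --> fine (\esum_(i in [set: I]) (x i)%:E)%E.
Proof.
move=> x0 xfin; have /fineK sE := esum_fin x0 xfin.
set s := fine _ in sE *.
apply/cvgrPdist_lt => e e0.
have : ((s - e)%:E < \esum_(i in [set: I]) (x i)%:E)%E.
  by rewrite -sE lte_fin ltrBlDr ltrDl.
move=> /ereal_sup_gt[_ [X [finX _] <-]].
rewrite fsbig_finite//= sumEFin lte_fin => hX.
exists (fset_set X) => // A /= XA.
rewrite partial_sumE.
have le1 : \sum_(i <- A) x i <= s.
  by rewrite -lee_fin sE; apply: fset_sum_le_esum.
have le2 := ler_sum_fsubset x0 XA.
by rewrite ger0_norm ?subr_ge0//; lra.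
Qed.

Lemma abs_summable_le I (x y : I -> R) :
  (forall i, `|x i| <= `|y i|) -> abs_summable y -> abs_summable x.
Proof.
move=> xy; apply: le_lt_trans; apply: le_esum => i _.
by rewrite lee_fin.
Qed.

Lemma abs_summableD I (x y : I -> R) :
  abs_summable x -> abs_summable y -> abs_summable (x \+ y).
Proof.
move=> hx hy; apply: (@le_lt_trans _ _
  (\esum_(i in [set: I]) (`|x i|%:E + `|y i|%:E))%E).
  by apply: le_esum => i _; rewrite -EFinD lee_fin ler_normD.
by rewrite esumD ?lte_add_pinfty.
Qed.

Lemma abs_summable_fset I (x : I -> R) (S : {fset I}) :
  (forall i, i \notin S -> x i = 0) -> abs_summable x.
Proof.
move=> xS; apply: (@le_lt_trans _ _ (\sum_(i <- S) `|x i|)%:E); last first.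
  exact: ltry.
apply: esum_le_fset => A _; rewrite lee_fin.
rewrite (big_fset_incl _ (fsubsetUr A S)) => [|i _ /xS ->]; last exact: normr0.
exact: ler_sum_fsubset (fsubsetUl A S).
Qed.

Lemma abs_summableZ I (c : R) (x : I -> R) :
  abs_summable x -> abs_summable (fun i => c * x i).
Proof.
move=> hx.
have x0 i : 0 <= `|x i| by [].
have /fineK sE := esum_fin x0 hx.
apply: (@le_lt_trans _ _ (`|c| * fine (\esum_(i in [set: I]) (`|x i|)%:E)%E)%:E).
  apply: esum_le_fset => A _; rewrite lee_fin.
  under eq_bigr do rewrite normrM.
  rewrite -mulr_sumr ler_wpM2l// -lee_fin sE.
  exact: fset_sum_le_esum.
exact: ltry.
Qed.

Lemma abs_summable_sum I (J : Type) (r : seq J) (P : pred J) (x : J -> I -> R) :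
  (forall j, P j -> abs_summable (x j)) ->
  abs_summable (fun i => \sum_(j <- r | P j) x j i).
Proof.
move=> h; elim: r => [|j r IH].
  by apply: (@abs_summable_fset _ _ fset0) => i _; rewrite big_nil.
under eq_fun do rewrite big_cons.
by case E: (P j) => //; apply: abs_summableD => //; exact: h.
Qed.

(** Split [x] into its positive and negative parts, each a nonnegative family dominated by [|x|]. *)
Lemma cvg_partial_sum I (x : I -> R) : abs_summable x ->
  partial_sum x @ totally -->
    fine (\esum_(i in [set: I]) (Num.max (x i) 0)%:E)%E
    - fine (\esum_(i in [set: I]) (Num.max (- x i) 0)%:E)%E.
Proof.
move=> hx.
have -> : partial_sum x = partial_sum (fun i => Num.max (x i) 0)
    \- partial_sum (fun i => Num.max (- x i) 0).
  apply/funext => A /=; rewrite !partial_sumE -sumrB; apply: eq_bigr => i _.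
  by rewrite /Num.max; case: ltP => ?; case: ltP => ?; lra.
by apply: cvgB; apply: cvg_partial_sum_ge0 => [i|];
  rewrite ?le_max ?lexx ?orbT//; apply: le_lt_trans hx; apply: le_esum => i _;
  rewrite lee_fin ge_max normr_ge0 andbT ?ler_norm// -normrN ler_norm.
Qed.

End AbsolutelySummable.

(** * Linearity and translation invariance of unconditional sums *)

Section Rsum.
Context {R : realType}.
Implicit Types (x y : Z2 -> R).

Lemma rsumE x : abs_summable x ->
  rsum x = fine (\esum_(i in [set: Z2]) (Num.max (x i) 0)%:E)%E
    - fine (\esum_(i in [set: Z2]) (Num.max (- x i) 0)%:E)%E.
Proof.
by move=> /cvg_partial_sum h; apply: (@cvg_lim R^o) => //; exact: h.
Qed.

Lemma cvg_rsum x : abs_summable x -> partial_sum x @ totally --> rsum x.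
Proof. by move=> hx; rewrite rsumE//; exact: cvg_partial_sum. Qed.

Lemma rsum_unique x (s : R) : partial_sum x @ totally --> s -> rsum x = s.
Proof. by move=> h; apply: (@cvg_lim R^o) => //; exact: h. Qed.

Lemma rsum_ge0E x : (forall i, 0 <= x i) -> abs_summable x ->
  (rsum x)%:E = (\esum_(i in [set: Z2]) (x i)%:E)%E.
Proof.
move=> x0; rewrite /abs_summable.
under eq_esum do rewrite ger0_norm//.
move=> hx; have /rsum_unique -> := cvg_partial_sum_ge0 x0 hx.
by rewrite fineK// esum_fin.
Qed.

Lemma rsumD x y : abs_summable x -> abs_summable y ->
  rsum (x \+ y) = rsum x + rsum y.
Proof.
move=> hx hy; apply: rsum_unique.
have -> : partial_sum (x \+ y) = partial_sum x \+ partial_sum y.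
  by apply/funext => A /=; rewrite !partial_sumE -big_split.
by apply: cvgD; exact: cvg_rsum.
Qed.

Lemma rsumZ (c : R) x : abs_summable x ->
  rsum (fun i => c * x i) = c * rsum x.
Proof.
move=> hx; apply: rsum_unique.
have -> : partial_sum (fun i => c * x i) = (fun A => c * partial_sum x A).
  by apply/funext => A /=; rewrite !partial_sumE mulr_sumr.
by apply: cvgM; [exact: cvg_cst|exact: cvg_rsum].
Qed.

Lemma rsum_fset x (S : {fset Z2}) : (forall i, i \notin S -> x i = 0) ->
  rsum x = \sum_(i <- S) x i.
Proof.
move=> xS; apply: rsum_unique; apply: cvg_near_cst.
exists S => // A /= SA; rewrite partial_sumE.
by apply/esym/big_fset_incl => // i _ /xS.
Qed.

Lemma rsum_sum (J : Type) (r : seq J) (P : pred J) (x : J -> Z2 -> R) :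
  (forall j, P j -> abs_summable (x j)) ->
  rsum (fun i => \sum_(j <- r | P j) x j i) = \sum_(j <- r | P j) rsum (x j).
Proof.
move=> h; elim: r => [|j r IH].
  rewrite big_nil (@rsum_fset _ fset0) ?big_seq_fset0// => i _.
  by rewrite big_nil.
rewrite big_cons; under eq_fun do rewrite big_cons.
case: ifPn => // Pj; rewrite -IH -rsumD//; first exact: h.
exact: abs_summable_sum.
Qed.

Lemma bij_shift (a : Z2) : set_bij [set: Z2] [set: Z2] (fun n => n + a).
Proof.
split => // [u v _ _ /addIr//|v _].
by exists (v - a) => //; rewrite subrK.
Qed.

Lemma esum_shift (a : Z2) (f : Z2 -> \bar R) :
  (\esum_(n in [set: Z2]) f (n + a)%R = \esum_(n in [set: Z2]) f n)%E.
Proof. exact: esym (reindex_esum _ _ _ f (bij_shift a)). Qed.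

Lemma abs_summable_shift (a : Z2) x :
  abs_summable x -> abs_summable (fun n => x (n + a)).
Proof.
by rewrite /abs_summable (esum_shift a (fun n => (`|x n|)%:E)).
Qed.

(** Writing both sums as differences of nonnegative extended sums reduces the claim to reindexing
    those along a bijection. *)
Lemma rsum_shift (a : Z2) x : abs_summable x ->
  rsum (fun n => x (n + a)) = rsum x.
Proof.
move=> hx; rewrite (rsumE (abs_summable_shift a hx)) (rsumE hx).
by rewrite (esum_shift a (fun n => (Num.max (x n) 0)%:E))
           (esum_shift a (fun n => (Num.max (- x n) 0)%:E)).
Qed.

End Rsum.

(** * Orthogonality of the characters modulo [M] *)

Section TrigonometricSums.
Context {R : realType}.

Lemma cos_2pi_int (s : int) : cos (2 * pi * s%:~R) = 1 :> R.
Proof.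
suff h n : cos (2 * pi * n%:R) = 1 :> R.
  by case: s => n; rewrite ?NegzE ?rmorphN/= ?mulrN ?cosN h.
rewrite mulr_natr -[_ *+ n]add0r [2 * pi]mulr_natl.
by rewrite (periodicn (@cosD2pi R)) cos0.
Qed.

Lemma sin_2pi_int (s : int) : sin (2 * pi * s%:~R) = 0 :> R.
Proof.
suff h n : sin (2 * pi * n%:R) = 0 :> R.
  by case: s => n; rewrite ?NegzE ?rmorphN/= ?mulrN ?sinN h ?oppr0.
rewrite mulr_natr -[_ *+ n]add0r [2 * pi]mulr_natl.
by rewrite (periodicn (@sinD2pi R)) sin0.
Qed.

(** By periodicity [s] may be replaced by its remainder [r], with [0 < r < M]. Then
    [cos (2 x) = 1 - 2 sin^2 x] at [x = pi r / M], which lies strictly between [0] and [pi]. *)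
Lemma cos_lt1 (M : nat) (s : int) : (0 < M)%N -> ~~ (M %| s)%Z ->
  cos (2 * pi * (s%:~R / M%:R)) < 1 :> R.
Proof.
move=> M0 Ms.
have M0' : (M%:R : R) != 0 by rewrite pnatr_eq0 -lt0n.
have Mz : (M : int) != 0 by rewrite eqz_nat -lt0n.
set r := (s %% M)%Z.
have r0 : r != 0 by apply: contra Ms => /eqP h; apply/dvdz_mod0P.
have rgt0 : 0 < r by rewrite lt_def r0 modz_ge0.
have rltM : r < M by rewrite ltz_pmod.
have -> : s%:~R / M%:R = r%:~R / M%:R + (s %/ M)%Z%:~R :> R.
  by rewrite {1}(divz_eq s M) rmorphD rmorphM/= mulrDl mulfK// addrC.
rewrite mulrDr cosD cos_2pi_int sin_2pi_int mulr1 mulr0 subr0.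
have -> : 2 * pi * (r%:~R / M%:R) = (pi * (r%:~R / M%:R)) *+ 2 :> R.
  by rewrite mulr2n; ring.
rewrite cos_mulr2n mulr2n cos2sin2.
suff : 0 < sin (pi * (r%:~R / M%:R)) :> R by move=> h; nra.
have MR : (0 : R) < M%:R by rewrite ltr0n.
have rR : (0 : R) < r%:~R by rewrite ltr0z.
apply: sin_gt0_pi; rewrite mulr_gt0 ?pi_gt0 ?divr_gt0//=.
by rewrite gtr_pMr ?pi_gt0// ltr_pdivrMr// mul1r -[M%:R]/(M%:Z%:~R) ltr_int.
Qed.

Lemma sum_shift_period (f : nat -> R) (M : nat) : f M = f 0%N ->
  \sum_(m < M) f m.+1 = \sum_(m < M) f m.
Proof.
move=> fM; apply/eqP; rewrite -subr_eq0 -sumrB.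
by rewrite -(big_mkord xpredT (fun m => f m.+1 - f m)) telescope_sumr// fM subrr.
Qed.

(** If [M] divides [s], all angles are multiples of [2 pi]. Otherwise, advancing [m] by one rotates
    the vector of the two sums by [t = 2 pi s / M] but also leaves it unchanged; a rotation with
    [cos t < 1] fixes only the zero vector. *)
Lemma sum_cos_sin (M : nat) (s : int) : (0 < M)%N ->
  \sum_(m < M) cos (2 * pi * (m%:R / M%:R) * s%:~R) =
    M%:R * (M %| s)%Z%:R :> R /\
  \sum_(m < M) sin (2 * pi * (m%:R / M%:R) * s%:~R) = 0 :> R.
Proof.
move=> M0.
have M0' : (M%:R : R) != 0 by rewrite pnatr_eq0 -lt0n.
have [/dvdzP[q ->]|Ms] := boolP (M %| s)%Z.
  have E (m : 'I_M) :
      2 * pi * (m%:R / M%:R) * (q * M)%:~R = 2 * pi * (m%:Z * q)%:~R :> R.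
    by rewrite !rmorphM/= -[(M : int)%:~R]/(M%:R) -[m%:Z%:~R]/(m%:R); field.
  split; under eq_bigr do rewrite E ?cos_2pi_int ?sin_2pi_int.
    by rewrite sumr_const card_ord mulr1.
  by rewrite sumr_const mul0rn.
set t := 2 * pi * (s%:~R / M%:R) : R.
have E m : 2 * pi * (m%:R / M%:R) * s%:~R = t * m%:R :> R.
  by rewrite /t; ring.
have ES m : t * m.+1%:R = t * m%:R + t by rewrite -natr1 mulrDr mulr1.
have EM : t * M%:R = 2 * pi * s%:~R by rewrite /t; field.
have hc := @sum_shift_period (fun m => cos (t * m%:R)) M.
have hs := @sum_shift_period (fun m => sin (t * m%:R)) M.
rewrite EM mulr0 cos_2pi_int sin_2pi_int cos0 sin0 in hc hs.
move: (hc erefl) (hs erefl) => {hc hs}.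
under eq_bigr do rewrite ES cosD.
rewrite sumrB -!mulr_suml => hc.
under eq_bigr do rewrite ES sinD.
rewrite big_split/= -!mulr_suml => hs.
under eq_bigr do rewrite E.
under [X in _ /\ X = _]eq_bigr do rewrite E.
move: hc hs; set C := \sum_(_ < _) _; set D := \sum_(_ < _) _ => hc hs.
have t1 := cos_lt1 M0 Ms; rewrite -/t in t1.
have d0 : 0 < (1 - cos t) ^+ 2 + sin t ^+ 2.
  by apply: ltr_pwDl; rewrite ?sqr_ge0// exprn_gt0// subr_gt0.
(* Cramer's rule: the factor [d0] is the determinant of the identity minus the rotation by [t]. *)
rewrite mulr0; split; apply: (mulfI (lt0r_neq0 d0)); rewrite mulr0.
  transitivity ((1 - cos t) * (C - (C * cos t - D * sin t))
      - sin t * (D - (D * cos t + C * sin t))); first ring.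
  by rewrite hc hs !subrr !mulr0 subr0.
transitivity ((1 - cos t) * (D - (D * cos t + C * sin t))
    + sin t * (C - (C * cos t - D * sin t))); first ring.
by rewrite hc hs !subrr !mulr0 addr0.
Qed.

End TrigonometricSums.

(** * The Euclidean inner product on quaternions *)

Section QuaternionDot.
Context {R : realType}.
Notation H := (quaternion R).
Implicit Types p q u v : H.

Definition dotq p q : R := qre (conjq p * q).

Lemma dotqE p q :
  dotq p q = qre p * qre q + qi p * qi q + qj p * qj q + qk p * qk q.
Proof. by rewrite /dotq/=; ring. Qed.

Lemma dotqq_ge0 p : 0 <= dotq p p.
Proof. by rewrite dotqE -!expr2 !addr_ge0 ?sqr_ge0. Qed.

Lemma absq_sqr p : absq p ^+ 2 = dotq p p.
Proof.
rewrite /absq sqr_sqrtr; first by rewrite dotqE; ring.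
by rewrite !addr_ge0 ?sqr_ge0.
Qed.

Lemma dotqDl p q u : dotq (p + q) u = dotq p u + dotq q u.
Proof. by rewrite !dotqE/=; ring. Qed.

Lemma dotqDr p q u : dotq u (p + q) = dotq u p + dotq u q.
Proof. by rewrite !dotqE/=; ring. Qed.

Lemma dotq_sumr (J : Type) (r : seq J) (P : pred J) p (F : J -> H) :
  dotq p (\sum_(j <- r | P j) F j) = \sum_(j <- r | P j) dotq p (F j).
Proof.
apply: (big_morph (dotq p)) => [u v|]; first exact: dotqDr.
by rewrite dotqE/= !mulr0 !addr0.
Qed.

Lemma dotq_suml (J : Type) (r : seq J) (P : pred J) p (F : J -> H) :
  dotq (\sum_(j <- r | P j) F j) p = \sum_(j <- r | P j) dotq (F j) p.
Proof.
apply: (big_morph (fun q => dotq q p)) => [u v|]; first exact: dotqDl.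
by rewrite dotqE/= !mul0r !addr0.
Qed.

(** The adjoint of left multiplication by [u] is left multiplication by its conjugate; this brings
    matching exponentials next to each other. *)
Lemma dotqMl u v p q : dotq (u * p) (v * q) = dotq p (conjq u * v * q).
Proof. by rewrite !dotqE/=; ring. Qed.

Lemma dotq_realMr (c : R) p q : dotq p (realq c * q) = c * dotq p q.
Proof. by rewrite !dotqE/=; ring. Qed.

Lemma dotq_realM (c d : R) p q :
  dotq (realq c * p) (realq d * q) = c * d * dotq p q.
Proof. by rewrite !dotqE/=; ring. Qed.

(** The two one-sided differences are [|p + q|^2 / 2] and [|p - q|^2 / 2]. *)
Lemma norm_dotq_le p q : `|dotq p q| <= (dotq p p + dotq q q) / 2.
Proof.
rewrite !dotqE ler_norml; apply/andP; split; rewrite -subr_ge0.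
  have -> : forall a b c d a' b' c' d' : R,
    a * a' + b * b' + c * c' + d * d' -
    - ((a * a + b * b + c * c + d * d + (a' * a' + b' * b' + c' * c' + d' * d')) / 2)
    = ((a + a') ^+ 2 + (b + b') ^+ 2 + (c + c') ^+ 2 + (d + d') ^+ 2) / 2.
    by move=> *; field.
  by rewrite divr_ge0// !addr_ge0 ?sqr_ge0.
have -> : forall a b c d a' b' c' d' : R,
  (a * a + b * b + c * c + d * d + (a' * a' + b' * b' + c' * c' + d' * d')) / 2
  - (a * a' + b * b' + c * c' + d * d')
  = ((a - a') ^+ 2 + (b - b') ^+ 2 + (c - c') ^+ 2 + (d - d') ^+ 2) / 2.
  by move=> *; field.
by rewrite divr_ge0// !addr_ge0 ?sqr_ge0.
Qed.

(** The right side minus the left side is exactly [|e p - q|^2 / e]. *)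
Lemma absq_sqrD_le (e : R) p q : 0 < e ->
  absq (p + q) ^+ 2 <= (1 + e) * absq p ^+ 2 + (1 + e^-1) * absq q ^+ 2.
Proof.
move=> e0; rewrite !absq_sqr dotqDl !dotqDr.
have h : 0 <= e^-1 * dotq (realq e * p + - q) (realq e * p + - q).
  by rewrite mulr_ge0 ?dotqq_ge0// invr_ge0 ltW.
rewrite -subr_ge0; apply: le_trans h _; rewrite le_eqVlt; apply/orP; left.
apply/eqP; rewrite !dotqE/=; field; lra.
Qed.

End QuaternionDot.

(** * Summing the energy over all modulations *)

Section ModulationSum.
Context {R : realType}.
Notation H := (quaternion R).

Definition congrZ2 (M : nat) (k k' : Z2) : bool :=
  (M %| k.1 - k'.1)%Z && (M %| k.2 - k'.2)%Z.

Definition phase (M : nat) (m : 'I_M) (s : int) : R :=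
  2 * pi * (m%:R / M%:R) * s%:~R.

Lemma conj_expj_mul (a b : R) : conjq (expj (- a)) * expj (- b) = expj (a - b).
Proof.
by rewrite /conjq /expj/= cosB sinB !cosN !sinN; congr Quat => /=; ring.
Qed.

Lemma sum_expj (M : nat) (s s' : int) : (0 < M)%N ->
  \sum_(m < M) expj (phase m s - phase m s') =
  realq (M%:R * (M %| s - s')%Z%:R).
Proof.
move=> M0; rewrite /realq -(sum_cos_sin (s - s') M0).1.
(* The vanishing sine sum is put in the [j] coordinate, so that the identity can be proved by
   induction on the sum, coordinate by coordinate. *)
have -> : Quat (\sum_(m < M) cos (2 * pi * (m%:R / M%:R) * (s - s')%:~R)) 0 0 0
  = Quat (\sum_(m < M) cos (2 * pi * (m%:R / M%:R) * (s - s')%:~R)) 0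
     (\sum_(m < M) sin (2 * pi * (m%:R / M%:R) * (s - s')%:~R)) 0 :> H.
  by rewrite (sum_cos_sin (s - s') M0).2.
apply: (big_rec3 (fun x y (z : H) => z = Quat x 0 y 0)) => // m x y z _ ->.
rewrite /expj /phase -mulrBr -rmorphB/=.
by congr Quat => /=; rewrite ?addr0.
Qed.

Lemma sum_expi (M : nat) (s s' : int) : (0 < M)%N ->
  \sum_(m < M) expi (phase m s - phase m s') =
  realq (M%:R * (M %| s - s')%Z%:R).
Proof.
move=> M0; rewrite /realq -(sum_cos_sin (s - s') M0).1.
have -> : Quat (\sum_(m < M) cos (2 * pi * (m%:R / M%:R) * (s - s')%:~R)) 0 0 0
  = Quat (\sum_(m < M) cos (2 * pi * (m%:R / M%:R) * (s - s')%:~R))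
     (\sum_(m < M) sin (2 * pi * (m%:R / M%:R) * (s - s')%:~R)) 0 0 :> H.
  by rewrite (sum_cos_sin (s - s') M0).2.
apply: (big_rec3 (fun x y (z : H) => z = Quat x y 0 0)) => // m x y z _ ->.
rewrite /expi /phase -mulrBr -rmorphB/=.
by congr Quat => /=; rewrite ?addr0.
Qed.

Lemma conj_expi_mul (a b : R) (c : R) :
  conjq (expi (- a)) * realq c * expi (- b) = realq c * expi (a - b).
Proof.
by rewrite /conjq /expi/= cosB sinB !cosN !sinN; congr Quat => /=; ring.
Qed.

(* The sum over [m.2] turns the inner j-exponentials into a real number,
   which commutes with the outer i-exponentials. *)
Lemma sum_dotq_modulation (M : nat) (S : seq Z2) (F : Z2 -> H) : (0 < M)%N ->
  \sum_(m : 'I_M * 'I_M)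
    absq (\sum_(k <- S) expj (- phase m.2 k.2) *
                        (expi (- phase m.1 k.1) * F k)) ^+ 2 =
  \sum_(k <- S) \sum_(k' <- S)
    M%:R ^+ 2 * ((congrZ2 M k k')%:R * dotq (F k) (F k')).
Proof.
move=> M0; under eq_bigr do rewrite absq_sqr dotq_suml.
rewrite exchange_big/=; apply: eq_bigr => k _.
under eq_bigr do rewrite dotq_sumr.
rewrite exchange_big/=; apply: eq_bigr => k' _.
rewrite -(pair_bigA _ (fun m1 m2 : 'I_M =>
  dotq (expj (- phase m2 k.2) * (expi (- phase m1 k.1) * F k))
       (expj (- phase m2 k'.2) * (expi (- phase m1 k'.1) * F k'))))/=.
transitivity (\sum_(m < M) (M%:R * (M %| k.2 - k'.2)%Z%:R) *
    dotq (F k) (expi (phase m k.1 - phase m k'.1) * F k')).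
  apply: eq_bigr => m1 _.
  under eq_bigr do rewrite dotqMl conj_expj_mul.
  rewrite -dotq_sumr -mulr_suml sum_expj// mulrA dotqMl !mulrA.
  by rewrite conj_expi_mul -mulrA dotq_realMr.
rewrite -mulr_sumr -dotq_sumr -mulr_suml sum_expi//.
rewrite dotq_realMr /congrZ2 -mulnb natrM.
ring.
Qed.

End ModulationSum.

Lemma abs_summable_inj (R : realType) (I J : choiceType) (e : J -> I)
    (x : I -> R) :
  injective e -> abs_summable x -> abs_summable (x \o e).
Proof.
move=> e_inj; apply: le_lt_trans; apply: esum_le_fset => A _.
have -> : \sum_(j <- A) `|(x \o e) j| = \sum_(i <- (e @` A)%fset) `|x i|.
  by rewrite big_imfset//= => i j _ _ /e_inj.
exact: fset_sum_le_esum.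
Qed.

(** * Quaternion-valued sums and the [l2] norm *)

Section QuaternionSum.
Context {R : realType}.
Notation H := (quaternion R).
Implicit Types (f h : Z2 -> H).

Definition qsummable f : Prop :=
  [/\ abs_summable (@qre R \o f), abs_summable (@qi R \o f),
      abs_summable (@qj R \o f) & abs_summable (@qk R \o f)].

Lemma qsummable_le f (y : Z2 -> R) : (forall k, 0 <= y k) ->
  (forall k, absq (f k) ^+ 2 <= y k ^+ 2) -> abs_summable y -> qsummable f.
Proof.
move=> y0 fy hy.
split; apply: abs_summable_le hy => k /=; rewrite -ler_sqr ?nnegrE//;
  rewrite !real_normK ?num_real//; apply: le_trans (fy k);
  rewrite absq_sqr dotqE -!expr2;
  have := sqr_ge0 (qre (f k)); have := sqr_ge0 (qi (f k));
  have := sqr_ge0 (qj (f k)); have := sqr_ge0 (qk (f k)); lra.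
Qed.

Lemma qsumD f h : qsummable f -> qsummable h -> qsum (f \+ h) = qsum f + qsum h.
Proof.
move=> [? ? ? ?] [? ? ? ?].
by rewrite /qsum; congr Quat; rewrite -rsumD.
Qed.

Lemma qcomp_sum (J : Type) (r : seq J) (P : pred J) (F : J -> H) :
  \sum_(j <- r | P j) F j =
  Quat (\sum_(j <- r | P j) qre (F j)) (\sum_(j <- r | P j) qi (F j))
       (\sum_(j <- r | P j) qj (F j)) (\sum_(j <- r | P j) qk (F j)).
Proof.
elim: r => [|j r IH]; first by rewrite !big_nil.
by rewrite !big_cons; case: (P j); rewrite IH.
Qed.

Lemma qsum_fset f (S : {fset Z2}) : (forall k, k \notin S -> f k = 0) ->
  qsum f = \sum_(k <- S) f k.
Proof.
move=> fS; rewrite qcomp_sum /qsum.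
by congr Quat; apply: rsum_fset => k /fS /= ->.
Qed.

(** The squared modulus is a polynomial in the four coordinates, each of which converges. *)
Lemma cvg_absq_qsum f : qsummable f ->
  (fun A : {fset Z2} => absq (\sum_(k <- A) f k) ^+ 2) @ totally -->
    absq (qsum f) ^+ 2.
Proof.
move=> [h1 h2 h3 h4].
rewrite absq_sqr dotqE/=.
under eq_fun do rewrite qcomp_sum absq_sqr dotqE/=.
under eq_fun do rewrite -!partial_sumE.
by do 3?[apply: cvgD]; apply: cvgM; exact: cvg_rsum.
Qed.

Lemma abs_summable_l2 h : l2 h <-> abs_summable (fun k => absq (h k) ^+ 2).
Proof. by rewrite /abs_summable; under eq_esum do rewrite ger0_norm ?sqr_ge0//. Qed.

Lemma l2norm_sqr h : l2 h ->
  (l2norm h ^+ 2)%:E = (\esum_(k in [set: Z2]) (absq (h k) ^+ 2)%:E)%E.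
Proof.
move=> /abs_summable_l2 hh.
have E : qre (inner h h) = rsum (fun k => absq (h k) ^+ 2).
  by rewrite /inner/=; congr rsum; apply/funext => k; rewrite absq_sqr.
have /esym hE := rsum_ge0E (fun k => sqr_ge0 (absq (h k))) hh.
rewrite /l2norm sqr_sqrtr E// -lee_fin -hE.
by apply: esum_ge0 => k _; rewrite lee_fin sqr_ge0.
Qed.

End QuaternionSum.

(** * Truncation to finite sets and its tail *)

Section Restriction.
Context {R : realType}.
Notation H := (quaternion R).
Implicit Types (h : Z2 -> H) (S : {fset Z2}).

Definition restr S h : Z2 -> H := fun k => if k \in S then h k else 0.
Definition corestr S h : Z2 -> H := fun k => if k \in S then 0 else h k.

Lemma absq0 : absq 0 = 0 :> R.
Proof. by rewrite /absq/= expr0n !addr0 sqrtr0. Qed.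

Lemma restrD S h : restr S h \+ corestr S h = h.
Proof.
by apply/funext => k; rewrite /restr /corestr/=; case: ifP; rewrite ?addr0 ?add0r.
Qed.

Lemma l2_restr S h : l2 h -> l2 (restr S h).
Proof.
apply: le_lt_trans; apply: le_esum => k _; rewrite lee_fin /restr.
by case: ifP => // _; rewrite absq0 expr0n sqr_ge0.
Qed.

Lemma l2_corestr S h : l2 h -> l2 (corestr S h).
Proof.
apply: le_lt_trans; apply: le_esum => k _; rewrite lee_fin /corestr.
by case: ifP => // _; rewrite absq0 expr0n sqr_ge0.
Qed.

Lemma l2norm_restr S h : l2 h ->
  l2norm (restr S h) ^+ 2 = \sum_(k <- S) absq (h k) ^+ 2.
Proof.
move=> hh; have hS := l2_restr S hh.
apply: EFin_inj; rewrite l2norm_sqr//.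
rewrite -(rsum_ge0E (fun k => sqr_ge0 _) ((abs_summable_l2 _).1 hS)).
rewrite (@rsum_fset _ _ S); last first.
  by move=> k /negbTE kS; rewrite /restr kS absq0 expr0n.
by congr EFin; apply: eq_big_seq => k; rewrite /restr => ->.
Qed.

Lemma l2norm_restr_corestr S h : l2 h ->
  l2norm h ^+ 2 = l2norm (restr S h) ^+ 2 + l2norm (corestr S h) ^+ 2.
Proof.
move=> hh; apply: EFin_inj; rewrite EFinD.
rewrite !l2norm_sqr//; [|exact: l2_corestr|exact: l2_restr].
rewrite -esumD; try by move=> k _; rewrite lee_fin sqr_ge0.
apply: eq_esum => k _; rewrite -EFinD; congr EFin.
by rewrite /restr /corestr; case: ifP; rewrite absq0 expr0n/= ?addr0 ?add0r.
Qed.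

(** Take a finite set carrying all but [e] of the squared norm; by the Pythagorean splitting the
    rest is the tail. *)
Lemma l2norm_corestr_small h (e : R) : l2 h -> 0 < e ->
  exists S, l2norm (corestr S h) ^+ 2 < e.
Proof.
move=> hh e0.
have : ((l2norm h ^+ 2 - e)%:E <
        \esum_(k in [set: Z2]) (absq (h k) ^+ 2)%:E)%E.
  by rewrite -l2norm_sqr// lte_fin ltrBlDr ltrDl.
move=> /ereal_sup_gt[_ [X [finX _] <-]].
rewrite fsbig_finite//= sumEFin lte_fin -l2norm_restr// => hX.
exists (fset_set X); move: hX; rewrite (l2norm_restr_corestr (fset_set X) hh).
lra.
Qed.

End Restriction.

(** * Correlations along the lattice of translations, and Gram matrix rows *)

Section Correlation.
Context {R : realType}.
Variable N : nat.
Hypothesis N_gt0 : (0 < N)%N.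
Implicit Types (x : Z2 -> R) (k p n a : Z2).

Definition corr x k k' : R := rsum (fun n => x (k - n *+ N) * x (k' - n *+ N)).

Lemma fst_mulrn n (m : nat) : (n *+ m).1 = n.1 * m%:Z.
Proof. by rewrite (raddfMn (@fst int int)) -mulr_natr natz. Qed.

Lemma snd_mulrn n (m : nat) : (n *+ m).2 = n.2 * m%:Z.
Proof. by rewrite (raddfMn (@snd int int)) -mulr_natr natz. Qed.

Lemma mulrn_Z2_inj (m : nat) : (0 < m)%N -> injective (fun n : Z2 => n *+ m).
Proof.
move=> m0 [a b] [c d] h.
have m0' : m%:Z != 0 by rewrite eqz_nat -lt0n.
have /(mulIf m0') /= -> : (a, b).1 * m%:Z = (c, d).1 * m%:Z.
  by rewrite -!fst_mulrn h.
have /(mulIf m0') /= -> // : (a, b).2 * m%:Z = (c, d).2 * m%:Z.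
by rewrite -!snd_mulrn h.
Qed.

(** Use [|a b| <= a^2 + b^2]; as [n] varies, [j - n N] is injective because [N > 0], so each family
    of squares is a subfamily of a summable one. *)
Lemma abs_summable_corr x k k' : l2 (fun k => realq (x k)) ->
  abs_summable (fun n => x (k - n *+ N) * x (k' - n *+ N)).
Proof.
move=> /abs_summable_l2 hx.
have h j : abs_summable (fun n => absq (realq (x (j - n *+ N))) ^+ 2).
  apply: (@abs_summable_inj _ _ _ (fun n => j - n *+ N) _ _ hx) => a b.
  by move=> /addrI /oppr_inj /mulrn_Z2_inj; exact.
apply: abs_summable_le (abs_summableD (h k) (h k')) => n.
rewrite /= !absq_sqr !dotqE/= !mulr0 !addr0 -!expr2.
rewrite [leRHS]ger0_norm ?addr_ge0 ?sqr_ge0//.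
set a := x _; set b := x _.
have := sqr_ge0 (a + b); have := sqr_ge0 (a - b).
have := sqr_ge0 a; have := sqr_ge0 b.
by rewrite ler_norml => *; apply/andP; split; nra.
Qed.

Lemma corr_shift x k k' a : l2 (fun k => realq (x k)) ->
  corr x (k + a *+ N) (k' + a *+ N) = corr x k k'.
Proof.
move=> hx; rewrite -[RHS](rsum_shift (- a) (abs_summable_corr k k' hx)).
congr rsum; apply/funext => n.
by rewrite mulrnDl mulNrn !opprD !opprK !addrA (addrAC k) (addrAC k').
Qed.

Lemma gram_mx_corr (M : nat) x k p :
  gram_mx M N x k 0 p = corr x k (k + p *+ M).
Proof.
rewrite /gram_mx /mulzmx /corr; congr rsum; apply/funext => n.
by rewrite /trzmx /shift_mx mul0rn addr0.
Qed.

Lemma Z2_ordE k : exists (r : 'I_N * 'I_N) a, k = ordZ2 r + a *+ N.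
Proof.
have Nz : N%:Z != 0 by rewrite eqz_nat -lt0n.
have h (s : int) : exists (r : 'I_N) q, s = r%:Z + q * N%:Z.
  have h0 := modz_ge0 s Nz.
  have hlt : (s %% N)%Z < N by rewrite ltz_pmod.
  have hN : (`|(s %% N)%Z| < N)%N by rewrite -ltz_nat gez0_abs.
  exists (Ordinal hN), (s %/ N)%Z.
  by rewrite /= gez0_abs// addrC -divz_eq.
have [r1 [q1 h1]] := h k.1; have [r2 [q2 h2]] := h k.2.
exists (r1, r2), (q1, q2).
rewrite [LHS]surjective_pairing [RHS]surjective_pairing h1 h2.
by rewrite -[q1]/((q1, q2).1) -fst_mulrn -[q2 in q2 * _]/((q1, q2).2) -snd_mulrn.
Qed.

(** Reduce [k] modulo [N] and use diagonal periodicity. The residue [r] is chosen before [x] and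
    [p], so one Gram row index serves all windows [g l] and all offsets. *)
Lemma corr_gram (M : nat) (k : Z2) : exists r : 'I_N * 'I_N,
  forall x p, l2 (fun k => realq (x k)) ->
    corr x k (k + p *+ M) = gram_mx M N x (ordZ2 r) 0 p.
Proof.
have [r [a ->]] := Z2_ordE k; exists r => x p hx.
by rewrite gram_mx_corr addrAC corr_shift.
Qed.

End Correlation.

(** * Schur and Gershgorin bounds for finite quadratic forms *)

Section QuadraticForm.
Context {R : realType}.
Notation H := (quaternion R).
Variables (S : {fset Z2}) (a : Z2 -> Z2 -> R) (h : Z2 -> H).
Hypothesis a_sym : forall k k', a k k' = a k' k.

Definition qform (b : Z2 -> Z2 -> R) : R :=
  \sum_(k <- S) \sum_(k' <- S) b k k' * dotq (h k) (h k').

(** Schur test: bound each cross term by the mean of the two squared moduli. *)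
Lemma norm_qform_le : `|qform a| <=
  \sum_(k <- S) (\sum_(k' <- S) `|a k k'|) * absq (h k) ^+ 2.
Proof.
apply: (@le_trans _ _ (\sum_(k <- S) \sum_(k' <- S)
  (`|a k k'| * absq (h k) ^+ 2 + `|a k k'| * absq (h k') ^+ 2) / 2)).
  apply: le_trans (ler_norm_sum _ _ _) _; apply: ler_sum => k _.
  apply: le_trans (ler_norm_sum _ _ _) _; apply: ler_sum => k' _.
  rewrite normrM -mulrDr -mulrA ler_wpM2l// !absq_sqr.
  exact: norm_dotq_le.
under eq_bigr do rewrite -mulr_suml big_split/=.
(* After exchanging the sums, symmetry of [a] turns the second half into the first. *)
rewrite -mulr_suml big_split/= [X in (_ + X) / _]exchange_big/=.
under [X in (_ + X) / _]eq_bigr do under eq_bigr do rewrite a_sym.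
set X := \sum_(k <- S) _; have -> : (X + X) / 2 = X by field.
by apply: ler_sum => k _; rewrite mulr_suml.
Qed.

End QuadraticForm.

Lemma absqN (R : rcfType) (q : quaternion R) : absq (- q) = absq q.
Proof. by rewrite /absq /= !sqrrN. Qed.

Section Gershgorin.
Context {R : realType}.
Notation H := (quaternion R).
Variables (S : {fset Z2}) (a : Z2 -> Z2 -> R) (h : Z2 -> H).
Hypothesis a_sym : forall k k', a k k' = a k' k.

(* Gershgorin: split off the diagonal and bound the rest by its row sums. *)
Lemma qform_ge (c : R) :
  (forall k, k \in S -> c <= a k k - \sum_(k' <- S | k' != k) `|a k k'|) ->
  c * \sum_(k <- S) absq (h k) ^+ 2 <= qform S h a.
Proof.
move=> hc; pose b k k' : R := if k' == k then 0 else a k k'.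
have b_sym k k' : b k k' = b k' k by rewrite /b eq_sym a_sym.
have -> : qform S h a = \sum_(k <- S) a k k * absq (h k) ^+ 2 + qform S h b.
  rewrite -big_split/=; apply: eq_big_seq => k kS.
  rewrite (big_fsetD1 k)//= [in RHS](big_fsetD1 k)//= /b eqxx mul0r add0r.
  rewrite absq_sqr; congr (_ + _); apply: eq_big_seq => k'.
  by rewrite !inE => /andP[/negbTE -> _].
have /ler_normlP[+ _] := norm_qform_le S h b_sym.
rewrite mulr_sumr lerNl => hb.
apply: le_trans (lerD (lexx _) hb); rewrite -sumrB -subr_ge0 -sumrB.
rewrite big_seq sumr_ge0// => k kS.
rewrite -!mulrBl mulr_ge0 ?sqr_ge0// subr_ge0; apply: le_trans (hc k kS) _.
rewrite lerD2l lerN2 [leRHS]big_mkcond/=; apply: ler_sum => k' _.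
by rewrite /b; case: eqP; rewrite ?normr0.
Qed.

Lemma qform_le (c : R) :
  (forall k, k \in S -> \sum_(k' <- S) `|a k k'| <= c) ->
  qform S h a <= c * \sum_(k <- S) absq (h k) ^+ 2.
Proof.
move=> hc; apply: le_trans (ler_norm _) _; apply: le_trans (norm_qform_le _ _ _) _ => //.
by rewrite mulr_sumr !big_seq ler_sum// => k kS; rewrite ler_wpM2r ?sqr_ge0 ?hc.
Qed.

End Gershgorin.

(** The points of [S] congruent to [k] are the [k + p M] with [p] the coordinatewise quotient, and
    this [p] determines the point. The membership clause serves to exclude [p = 0] once [k] is
    removed from [S]. *)
Lemma sum_congrZ2 (R : realType) (M : nat) (S : {fset Z2}) (k : Z2) (F : Z2 -> R) :
  (0 < M)%N -> exists P : {fset Z2},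
  (forall p, p \in P -> k + p *+ M \in S) /\
  \sum_(k' <- S | congrZ2 M k k') F k' = \sum_(p <- P) F (k + p *+ M).
Proof.
move=> M0.
pose q (k' : Z2) : Z2 := (((k'.1 - k.1) %/ M)%Z, ((k'.2 - k.2) %/ M)%Z).
have qK k' : congrZ2 M k k' -> k + q k' *+ M = k'.
  rewrite /congrZ2 -(opprB k'.1) -(opprB k'.2) !rpredN => /andP[d1 d2].
  rewrite [LHS]surjective_pairing [RHS]surjective_pairing /=.
  by rewrite fst_mulrn snd_mulrn /q/= !divzK// (addrC k.1) (addrC k.2) !subrK.
pose S' := [fset k' in S | congrZ2 M k k']%fset.
have S'P k' : k' \in S' -> k' \in S /\ congrZ2 M k k'.
  by rewrite !inE => /andP[].
exists (q @` S')%fset; split.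
  by move=> p /imfsetP[k' /= /S'P[k'S cc] ->]; rewrite qK.
rewrite big_fset_condE [RHS]big_imfset/=; last first.
  move=> k1 k2 /S'P[_ c1] /S'P[_ c2] e.
  by rewrite -(qK k1 c1) -(qK k2 c2) e.
by apply: eq_big_seq => k' k'S'; have [_ c] := S'P _ k'S'; rewrite qK.
Qed.

(** * The frame energy: finitely supported signals, then the passage to [l2] *)

Section Energy.
Context {R : realType}.
Notation H := (quaternion R).
Variables (L M N : nat) (g : 'I_L -> Z2 -> R).
Hypotheses (M_gt0 : (0 < M)%N) (N_gt0 : (0 < N)%N).
Hypothesis g_l2 : forall l, l2 (fun k => realq (g l k)).
Let G l k : H := realq (g l k).
Implicit Types (h : Z2 -> H) (S : {fset Z2}).

(** The share of one translation: with the finite sums inside, the energy is a single nonnegative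
    sum over [n]. *)
Definition gabor_at n h : R :=
  \sum_(l < L) \sum_(m : 'I_M * 'I_M) absq (inner (gabor N G l m n) h) ^+ 2.

Lemma gabor_at_ge0 n h : 0 <= gabor_at n h.
Proof. by apply: sumr_ge0 => l _; apply: sumr_ge0 => m _; exact: sqr_ge0. Qed.

Lemma gabor_energyE h :
  gabor_energy M N G h = (\esum_(n in [set: Z2]) (gabor_at n h)%:E)%E.
Proof.
rewrite /gabor_energy /gabor_at -esum_sum; last first.
  by move=> n l _ _; apply: sume_ge0 => m _; rewrite lee_fin sqr_ge0.
apply: eq_esum => n _; rewrite -sumEFin; apply: eq_bigr => l _.
by rewrite -sumEFin.
Qed.

(** Conjugation reverses products, so the [j]-exponential comes to stand on the left of the
    [i]-exponential, as [sum_dotq_modulation] requires. *)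
Definition gterm l (m : 'I_M * 'I_M) n h (k : Z2) : H :=
  expj (- phase m.2 k.2) *
    (expi (- phase m.1 k.1) * (realq (g l (k - n *+ N)) * h k)).

Lemma innerE l m n h :
  inner (gabor N G l m n) h = qsum (gterm l m n h).
Proof.
congr qsum; apply/funext => k.
rewrite /gabor /modulation /translation /gterm /G -!/(phase _ _) !mulrA.
congr (_ * _); rewrite /conjq /expi /expj/= !cosN !sinN; congr Quat => /=; ring.
Qed.

Lemma absq_gterm l m n h k :
  absq (gterm l m n h k) ^+ 2 = g l (k - n *+ N) ^+ 2 * absq (h k) ^+ 2.
Proof.
rewrite !absq_sqr /gterm.
have ei (t : R) : conjq (expi t) * expi t = 1.
  by rewrite /conjq /expi; congr Quat => /=;
    rewrite -?(cos2Dsin2 t); ring.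
have ej (t : R) : conjq (expj t) * expj t = 1.
  by rewrite /conjq /expj; congr Quat => /=;
    rewrite -?(cos2Dsin2 t); ring.
by rewrite dotqMl ej mul1r dotqMl ei mul1r dotq_realM -expr2.
Qed.

(** The exponentials have modulus one, so the term is dominated by [g^2 + |h|^2], a sum of two
    summable families. *)
Lemma qsummable_gterm l m n h : l2 h -> qsummable (gterm l m n h).
Proof.
move=> /abs_summable_l2 hh.
have := abs_summable_l2 (fun k => realq (g l k)).
move=> -[/(_ (g_l2 l)) hg _].
have hg' : abs_summable (fun k => absq (realq (g l (k - n *+ N))) ^+ 2).
  exact: (abs_summable_shift (- (n *+ N)) hg).
apply: (qsummable_le _ _ (abs_summableD hg' hh)) => k /=.
  by rewrite addr_ge0 ?sqr_ge0.
rewrite absq_gterm; set x := absq (h k).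
have -> : absq (realq (g l (k - n *+ N))) ^+ 2 = g l (k - n *+ N) ^+ 2.
  by rewrite absq_sqr dotqE/= !mulr0 !addr0 expr2.
set y := g l _; have := sqr_ge0 x; have := sqr_ge0 y.
set X := x ^+ 2; set Y := y ^+ 2 => Y0 X0.
by rewrite sqrrD; nra.
Qed.

(** The kernel [W(k, k')], before the restriction to pairs congruent modulo [M]. *)
Definition corrsum (k k' : Z2) : R := \sum_(l < L) corr N (g l) k k'.

Lemma corrsum_sym k k' : corrsum k k' = corrsum k' k.
Proof.
apply: eq_bigr => l _; congr rsum; apply/funext => n; exact: mulrC.
Qed.

(** Orthogonality of the modulations for each [l]. Only the last factor depends on [n], which
    prepares the summation over [n]. *)
Lemma gabor_at_restr n S h : gabor_at n (restr S h) =
  \sum_(k <- S) \sum_(k' <- S) (M%:R ^+ 2 * ((congrZ2 M k k')%:R *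
    dotq (h k) (h k'))) * \sum_(l < L) g l (k - n *+ N) * g l (k' - n *+ N).
Proof.
transitivity (\sum_(l < L) \sum_(k <- S) \sum_(k' <- S)
  (M%:R ^+ 2 * ((congrZ2 M k k')%:R * dotq (h k) (h k'))) *
     (g l (k - n *+ N) * g l (k' - n *+ N))).
  apply: eq_bigr => l _; transitivity (\sum_(m : 'I_M * 'I_M)
    absq (\sum_(k <- S) expj (- phase m.2 k.2) * (expi (- phase m.1 k.1)
       * (realq (g l (k - n *+ N)) * h k))) ^+ 2).
    apply: eq_bigr => m _; rewrite innerE (@qsum_fset _ _ S); last first.
      by move=> k /negbTE kS; rewrite /gterm /restr kS !mulr0.
    by congr (absq _ ^+ 2); apply: eq_big_seq => k kS; rewrite /gterm /restr kS.
  rewrite (sum_dotq_modulation _ (fun k => realq (g l (k - n *+ N)) * h k))//.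
  apply: eq_bigr => k _; apply: eq_bigr => k' _.
  by rewrite dotq_realM; ring.
rewrite exchange_big/=; apply: eq_bigr => k _.
rewrite exchange_big/=; apply: eq_bigr => k' _.
by rewrite mulr_sumr.
Qed.

(** Since [S] is finite, the sum over [n] can be taken inside the sums over [k] and [k'], where it
    produces the correlations. *)
Lemma gabor_energy_restr S h : gabor_energy M N G (restr S h) =
  (M%:R ^+ 2 * qform S h (fun k k' => (congrZ2 M k k')%:R * corrsum k k'))%:E.
Proof.
have hs k k' : abs_summable (fun n => \sum_(l < L)
    g l (k - n *+ N) * g l (k' - n *+ N)).
  by apply: abs_summable_sum => l _; exact: abs_summable_corr.
have hs2 : abs_summable (fun n => gabor_at n (restr S h)).
  under eq_fun do rewrite gabor_at_restr.
  apply: abs_summable_sum => k _; apply: abs_summable_sum => k' _.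
  exact: abs_summableZ.
rewrite gabor_energyE -rsum_ge0E//; last by move=> n; exact: gabor_at_ge0.
congr EFin; under eq_fun do rewrite gabor_at_restr.
rewrite rsum_sum; last first.
  by move=> k _; apply: abs_summable_sum => k' _; exact: abs_summableZ.
rewrite /qform mulr_sumr; apply: eq_bigr => k _.
rewrite rsum_sum; last by move=> k' _; exact: abs_summableZ.
rewrite mulr_sumr; apply: eq_bigr => k' _.
rewrite rsumZ// rsum_sum => [|l _]; last exact: abs_summable_corr.
by rewrite -/(corrsum k k'); ring.
Qed.

Lemma cvg_sumr (T : Type) (F : set_system T) (FF : Filter F) (J : Type)
    (r : seq J) (f : J -> T -> R) (l : J -> R) :
  (forall j, f j x @[x --> F] --> l j) ->
  \sum_(j <- r) f j x @[x --> F] --> \sum_(j <- r) l j.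
Proof.
move=> fl; elim: r => [|j r IH].
  by rewrite big_nil; under eq_fun do rewrite big_nil; exact: cvg_cst.
rewrite big_cons; under eq_fun do rewrite big_cons.
by apply: cvgD => //; exact: fl.
Qed.

(** Pairing with the truncation of [h] to [S] gives exactly the partial sum over [S] of the pairing
    with [h]. *)
Lemma cvg_gabor_at n h : l2 h ->
  gabor_at n (restr S h) @[S --> totally] --> gabor_at n h.
Proof.
move=> hh; apply: cvg_sumr => l; apply: cvg_sumr => m.
rewrite innerE.
have := cvg_absq_qsum (qsummable_gterm l m n hh).
apply: cvg_trans; apply: near_eq_cvg; apply: nearW => S.
rewrite innerE (@qsum_fset _ _ S); last first.
  by move=> k /negbTE kS; rewrite /gterm /restr kS !mulr0.
by congr (absq _ ^+ 2); apply: eq_big_seq => k kS; rewrite /gterm /restr kS.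
Qed.

(** A Fatou-type argument: finitely many translations pass to the limit in [S] under the uniform
    bound [B |h|^2], and the energy is the supremum over such finite sets. *)
Lemma gabor_energy_le (B : R) : 0 <= B ->
  (forall S h, (gabor_energy M N G (restr S h) <=
     (B * \sum_(k <- S) absq (h k) ^+ 2)%:E)%E) ->
  forall h, l2 h -> (gabor_energy M N G h <= (B * l2norm h ^+ 2)%:E)%E.
Proof.
move=> B0 hB h hh; rewrite gabor_energyE; apply: esum_le_fset => F _.
rewrite lee_fin.
have hcv : \sum_(n <- F) gabor_at n (restr S h) @[S --> totally]
    --> \sum_(n <- F) gabor_at n h.
  by apply: cvg_sumr => n; exact: cvg_gabor_at.
apply: (cvgr_to_le hcv); apply: nearW => S.
rewrite -lee_fin; apply: (@le_trans _ _ (gabor_energy M N G (restr S h))).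
  by rewrite gabor_energyE; exact: fset_sum_le_esum.
apply: le_trans (hB S h) _; rewrite lee_fin ler_wpM2l// -l2norm_restr//.
by rewrite (l2norm_restr_corestr S hh) lerDl sqr_ge0.
Qed.

(** The truncation is [h] minus its tail; apply [absq_sqrD_le] to every coefficient. *)
Lemma gabor_at_restr_le (e : R) n S h : l2 h -> 0 < e ->
  gabor_at n (restr S h) <=
    (1 + e) * gabor_at n h + (1 + e^-1) * gabor_at n (corestr S h).
Proof.
move=> hh e0.
rewrite /gabor_at !mulr_sumr -big_split; apply: ler_sum => l _.
rewrite /= !mulr_sumr -big_split; apply: ler_sum => m _ /=.
have -> : inner (gabor N G l m n) (restr S h) =
    inner (gabor N G l m n) h + - inner (gabor N G l m n) (corestr S h).
  rewrite !innerE -{2}(restrD S h); apply/eqP; rewrite -subr_eq opprK.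
  have hr := qsummable_gterm l m n (l2_restr S hh).
  rewrite -(qsumD hr (qsummable_gterm l m n (l2_corestr S hh))).
  apply/eqP; congr qsum; apply/funext => k.
  by rewrite /gterm/= -!mulrDr.
by apply: le_trans (absq_sqrD_le _ _ e0) _; rewrite absqN.
Qed.

(* The lower bound does not pass to the limit termwise; instead
   |x|^2 <= (1 + e) |x + y|^2 + (1 + 1/e) |y|^2 compares [h] with its
   restriction, the tail being controlled by the upper bound. *)
Lemma gabor_energy_ge (A B : R) : 0 < A -> 0 <= B ->
  (forall S h, ((A * \sum_(k <- S) absq (h k) ^+ 2)%:E <=
     gabor_energy M N G (restr S h))%E) ->
  (forall h, l2 h -> (gabor_energy M N G h <= (B * l2norm h ^+ 2)%:E)%E) ->
  forall h, l2 h -> ((A * l2norm h ^+ 2)%:E <= gabor_energy M N G h)%E.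
Proof.
move=> A0 B0 hA hB h hh.
have E0 x : (0 <= gabor_energy M N G x)%E.
  by rewrite gabor_energyE; apply: esum_ge0 => n _; rewrite lee_fin gabor_at_ge0.
have Efin x : l2 x -> (gabor_energy M N G x)%E \is a fin_num.
  by move=> /hB hx; rewrite ge0_fin_numE//; apply: le_lt_trans hx (ltry _).
pose E x := fine (gabor_energy M N G x).
have EK x : l2 x -> gabor_energy M N G x = (E x)%:E by move=> /Efin/fineK.
have Epos : 0 <= E h by rewrite fine_ge0.
rewrite EK// lee_fin.
have split_le e S : 0 < e -> A * (l2norm h ^+ 2 - l2norm (corestr S h) ^+ 2) <=
    (1 + e) * E h + (1 + e^-1) * (B * l2norm (corestr S h) ^+ 2).
  move=> e0; rewrite (l2norm_restr_corestr S hh) addrK l2norm_restr//.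
  rewrite -lee_fin; apply: le_trans (hA S h) _.
  have e1 : 0 <= 1 + e^-1 by rewrite addr_ge0// invr_ge0 ltW.
  apply: (@le_trans _ _
    ((1 + e) * E h + (1 + e^-1) * E (corestr S h))%:E); last first.
    rewrite lee_fin lerD2l ler_wpM2l// -lee_fin -EK; last exact: l2_corestr.
    by apply: hB; exact: l2_corestr.
  rewrite gabor_energyE; apply: esum_le_fset => F _; rewrite lee_fin.
  apply: (@le_trans _ _ (\sum_(n <- F)
      ((1 + e) * gabor_at n h + (1 + e^-1) * gabor_at n (corestr S h)))).
    by apply: ler_sum => n _; exact: gabor_at_restr_le.
  rewrite big_split/= -!mulr_sumr lerD// ler_wpM2l//.
  - by rewrite addr_ge0// ltW.
  - by rewrite -lee_fin -EK// gabor_energyE; exact: fset_sum_le_esum.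
  - rewrite -lee_fin -EK ?gabor_energyE; last exact: l2_corestr.
    exact: fset_sum_le_esum.
apply/ler_addgt0Pr => e e0.
(* The weight [d] is fixed first, so that the excess on [E h] costs at most [e / 2]; the [1 +] in
   the witness covers the case [E h = 0]. *)
have [d d0 hd] : exists2 d, 0 < d & d * E h <= e / 2.
  exists (e / 2 / (1 + E h)); first by rewrite !divr_gt0// ltr_pwDl.
  by rewrite mulrAC ler_pdivrMr ?ltr_pwDl// ler_wpM2l ?divr_ge0 ?ltW// ltr_pwDl.
(* [c] is the total coefficient of the squared tail in [split_le]; with [d] fixed, [S] is chosen to
   make that contribution less than [e / 2]. *)
set c := A + (1 + d^-1) * B.
have c0 : 0 < c by rewrite ltr_pwDl// mulr_ge0// addr_ge0// invr_ge0 ltW.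
have [S hS] := l2norm_corestr_small hh (divr_gt0 (divr_gt0 e0 (ltr0n _ 2)) c0).
have := split_le d S d0; rewrite ltr_pdivlMr// in hS.
move: hS; set r := l2norm (corestr S h) ^+ 2; rewrite /c; nra.
Qed.

End Energy.

(** * Row sums of the kernel against the Gram matrix bounds *)

Section RowBounds.
Context {R : realType}.
Variables (L M N : nat) (g : 'I_L -> Z2 -> R).
Hypotheses (M_gt0 : (0 < M)%N) (N_gt0 : (0 < N)%N).
Hypothesis g_l2 : forall l, l2 (fun k => realq (g l k)).
Implicit Types (k p : Z2) (S : {fset Z2}) (r : 'I_N * 'I_N).

(** This and [minrow] are the frame bounds without the factor [M^2], so that each can be shown to be
    a real number. *)
Definition maxrow : \bar R := \big[maxe/-oo%E]_(r : 'I_N * 'I_N)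
  (\esum_(p in [set: Z2])
    (`| \sum_(l < L) gram_mx M N (g l) (ordZ2 r) 0 p |%R)%:E)%E.

Definition minrow : \bar R := \big[mine/+oo%E]_(r : 'I_N * 'I_N)
  (\sum_(l < L) ((gram_mx M N (g l) (ordZ2 r) 0 0)%:E -
     \esum_(p in [set p : Z2 | p != 0%R])
        (`| gram_mx M N (g l) (ordZ2 r) 0 p |%R)%:E))%E.

Lemma fset_row_le_maxrow r (P : {fset Z2}) :
  ((\sum_(p <- P) `|\sum_(l < L) gram_mx M N (g l) (ordZ2 r) 0 p|)%:E
    <= maxrow)%E.
Proof.
apply: (@le_trans _ _ (\esum_(p in [set: Z2])
    (`| \sum_(l < L) gram_mx M N (g l) (ordZ2 r) 0 p |%R)%:E)%E).
  exact: fset_sum_le_esum.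
exact: (le_bigmax -oo%E (fun r => (\esum_(p in [set: Z2])
    (`| \sum_(l < L) gram_mx M N (g l) (ordZ2 r) 0 p |%R)%:E)%E)).
Qed.

(** [minrow] takes absolute values window by window; the triangle inequality over [l] passes to the
    summed Gram matrix, whose off-diagonal part is smaller. *)
Lemma minrow_le r (P : {fset Z2}) : 0 \notin P ->
  (minrow <= (\sum_(l < L) gram_mx M N (g l) (ordZ2 r) 0 0 -
    \sum_(p <- P) `|\sum_(l < L) gram_mx M N (g l) (ordZ2 r) 0 p|)%:E)%E.
Proof.
move=> P0; apply: (@le_trans _ _
  (\sum_(l < L) ((gram_mx M N (g l) (ordZ2 r) 0 0)%:E -
     \esum_(p in [set p : Z2 | p != 0%R])
        (`| gram_mx M N (g l) (ordZ2 r) 0 p |%R)%:E))%E).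
  exact: (bigmin_le +oo%E r (fun r => \sum_(l < L)
     ((gram_mx M N (g l) (ordZ2 r) 0 0)%:E -
     \esum_(p in [set p : Z2 | p != 0%R])
        (`| gram_mx M N (g l) (ordZ2 r) 0 p |%R)%:E))%E).
apply: (@le_trans _ _ (\sum_(l < L) (gram_mx M N (g l) (ordZ2 r) 0 0 -
    \sum_(p <- P) `|gram_mx M N (g l) (ordZ2 r) 0 p|))%:E).
  rewrite -sumEFin; apply: lee_sum => l _; rewrite EFinB leeB//.
  by apply: fset_sum_le_esum => p pP /=; apply: contraNneq P0 => <-.
rewrite lee_fin sumrB lerD2l lerN2 exchange_big/=.
by apply: ler_sum => p _; exact: ler_norm_sum.
Qed.

Lemma corrsum_gram k : exists r, forall p,
  corrsum N g k (k + p *+ M) = \sum_(l < L) gram_mx M N (g l) (ordZ2 r) 0 p.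
Proof.
have [r rE] := @corr_gram R N N_gt0 M k; exists r => p.
by apply: eq_bigr => l _; exact: rE.
Qed.

Definition gram_weight k k' : R := (congrZ2 M k k')%:R * corrsum N g k k'.

Lemma gram_weight_sym k k' : gram_weight k k' = gram_weight k' k.
Proof.
rewrite /gram_weight corrsum_sym /congrZ2.
by rewrite -(opprB k.1) -(opprB k.2) !rpredN.
Qed.

Lemma norm_gram_weight k k' :
  `|gram_weight k k'| = if congrZ2 M k k' then `|corrsum N g k k'| else 0.
Proof. by rewrite /gram_weight; case: ifP; rewrite ?mul1r// mul0r normr0. Qed.

(** The weight vanishes off the class of [k] modulo [M]; on that class, a row is part of a Gram row,
    indexed by [p]. *)
Lemma gram_weight_row_le k S :
  ((\sum_(k' <- S) `|gram_weight k k'|)%:E <= maxrow)%E.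
Proof.
under eq_bigr do rewrite norm_gram_weight.
rewrite -big_mkcond/=.
have [P [_ ->]] := sum_congrZ2 S k (fun k' => `|corrsum N g k k'|) M_gt0.
have [r rE] := corrsum_gram k.
by under eq_bigr do rewrite rE; exact: fset_row_le_maxrow.
Qed.

Lemma minrow_le_gram_weight k S :
  (minrow <= (gram_weight k k -
     \sum_(k' <- S | k' != k) `|gram_weight k k'|)%:E)%E.
Proof.
have [r rE] := corrsum_gram k.
pose S' := [fset k' in S | k' != k]%fset.
rewrite big_fset_condE/= -/S'.
under eq_bigr do rewrite norm_gram_weight.
rewrite -big_mkcond/=.
have [P [PS ->]] := sum_congrZ2 S' k (fun k' => `|corrsum N g k k'|) M_gt0.
have -> : gram_weight k k = corrsum N g k (k + 0 *+ M).
  by rewrite /gram_weight /congrZ2 !subrr !dvdz0 mul1r mul0rn addr0.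
rewrite rE; under [X in _ - X]eq_bigr do rewrite rE.
(* The offset [p = 0] would place [k] itself in [S'], from which it was removed. *)
apply: minrow_le; apply/negP => /PS.
by rewrite mul0rn addr0 !inE/= eqxx andbF.
Qed.

End RowBounds.

(** * Finiteness of the bounds and conclusion *)

Theorem theorem2 (R : realType) (L M N : nat)
    (L_gt0 : (0 < L)%N) (M_gt0 : (0 < M)%N) (N_gt0 : (0 < N)%N)
    (g : 'I_L -> Z2 -> R) (g_l2 : forall l, l2 (fun k => realq (g l k))) :
  let G := fun l k => realq (g l k) in
  let A := lower_bound M N g in
  let B := upper_bound M N g in
  (B < +oo)%E ->
  bessel_gabor M N G B /\ ((0 < A)%E -> gabor_frame M N G A B).
Proof.
move=> G A B Bfin.
have M2 : 0 < M%:R ^+ 2 :> R by rewrite exprn_gt0 ?ltr0n.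
have AE : A = ((M%:R ^+ 2)%:E * minrow M N g)%E by [].
have BE : B = ((M%:R ^+ 2)%:E * maxrow M N g)%E by [].
pose r0 : 'I_N * 'I_N := (Ordinal N_gt0, Ordinal N_gt0).
(* An empty partial row at the residue [r0], available as [N > 0], excludes the default value [-oo]
   of the maximum. *)
have max0 : (0 <= maxrow M N g)%E.
  apply: le_trans (fset_row_le_maxrow M g r0 fset0).
  by rewrite big_seq_fset0.
have [b bE] : exists b : R, maxrow M N g = b%:E.
  case: (maxrow M N g) max0 BE => [b _ _|_ BE|//]; first by exists b.
  by move: Bfin; rewrite BE gt0_muley ?lte_fin// ltxx.
have b0 : 0 <= b by rewrite -lee_fin -bE.
have BbE : B = (M%:R ^+ 2 * b)%:E by rewrite BE bE.
have B0 : 0 <= M%:R ^+ 2 * b by rewrite mulr_ge0// ltW.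
have hB h : l2 h ->
    (gabor_energy M N G h <= (M%:R ^+ 2 * b * l2norm h ^+ 2)%:E)%E.
  apply: (gabor_energy_le g_l2) => // S x.
  rewrite gabor_energy_restr// lee_fin -mulrA ler_wpM2l// ?(ltW M2)//.
  apply: qform_le => [k k'|k _]; first exact: gram_weight_sym.
  by rewrite -lee_fin -bE; exact: gram_weight_row_le.
split; first by split=> // h hh; rewrite BbE -EFinM; exact: hB.
move=> A0.
have min0 : (0 < minrow M N g)%E by move: A0; rewrite AE pmule_rgt0 ?lte_fin.
(* With no off-diagonal terms this bounds [minrow] by a real diagonal entry, which excludes
   [+oo]. *)
have minr0 := minrow_le M g r0 (P := fset0) (negbT (in_fset0 _)).
rewrite big_seq_fset0 subr0 in minr0.
have [a aE] : exists a : R, minrow M N g = a%:E.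
  by case: (minrow M N g) min0 minr0 => [a _ _|_|//]; [exists a|].
have a0 : 0 < a by rewrite -lte_fin -aE.
have AaE : A = (M%:R ^+ 2 * a)%:E by rewrite AE aE.
split => //.
  (* [A <= B] because the diagonal entry is at most the partial row over [p = 0] alone. *)
  rewrite AE BE lee_pmul2l ?lte_fin//; apply: le_trans minr0 _.
  apply: le_trans (fset_row_le_maxrow M g r0 [fset 0]%fset).
  by rewrite big_seq_fset1 lee_fin ler_norm.
move=> h hh; rewrite AaE BbE -!EFinM; split; last exact: hB.
apply: (gabor_energy_ge g_l2 _ B0 _ hB hh); first exact: mulr_gt0.
move=> S x; rewrite gabor_energy_restr// lee_fin -mulrA ler_wpM2l// ?(ltW M2)//.
apply: qform_ge => [k k'|k _]; first exact: gram_weight_sym.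
by rewrite -lee_fin -aE; exact: minrow_le_gram_weight.
Qed.
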